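(* Let $Q=\Bbbk[x_1,\dots,x_n]$ be a polynomial ring over a field $\Bbbk$, let $I=\langle m_1,\dots,m_r\rangle\subseteq Q$ be a monomial ideal with monomial generators $m_1,\dots,m_r$, and let $a_1,\dots,a_c\in Q$ be a regular sequence with $\mathfrak a=\langle a_1,\dots,a_c\rangle\subseteq I$. Fix polynomials $f_{i,j}\in Q$ ($i\in[c]$, $j\in[r]$) with $a_i=\sum_{j=1}^r f_{i,j}m_j$ for each $i$. Let $\mathbf T$ be the Taylor complex of $Q/I$ and define maps $\sigma_{\mathbf u}$ on $\mathbf T$, for $\mathbf u\in\mathbb N^c$, by: $\sigma_{\mathbf 0}=\tau$ (the Taylor differential); for each $i\in[c]$ and $S=\{s_1<\dots<s_k\}\subseteq[r]$, \[\sigma_{\mathbf e_i}(\varepsilon_S)=\sum_{t\in[r]\setminus S}(-1)^{k-p_{t,S}-1}\frac{f_{i,t}\,m_t\,m_S}{m_{S\cup\{t\}}}\,\varepsilon_{S\cup\{t\}},\] where $p_{t,S}$ is the position of $t$ in the increasingly ordered set $S\cup\{t\}$; and $\sigma_{\mathbf u}=0$ whenever $|\mathbf u|\ge 2$. Then: (1) $\{\sigma_{\mathbf u}\}$ is a system of higher homotopies for $a_1,\dots,a_c$ on $\mathbf T$; explicitly, $\sigma_{\mathbf e_i}\sigma_{\mathbf e_i}=0$ for all $i$, $\sigma_{\mathbf e_i}\sigma_{\mathbf e_j}+\sigma_{\mathbf e_j}\sigma_{\mathbf e_i}=0$ for all $i\neq j$, and $\tau\sigma_{\mathbf e_j}+\sigma_{\mathbf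 e_j}\tau$ is multiplication by $a_j$ on $\mathbf T$ for every $j$. (2) Consequently, with $R=Q/\mathfrak a$, the Eisenbud–Shamash complex $\Phi(\mathbf T)$ built from these maps is a free resolution of $R/I$ over $R$.
   Context: Notation: $[r]=\{1,\dots,r\}$. For $S=\{j_1,\dots,j_k\}\subseteq[r]$, $m_S=\operatorname{lcm}(m_{j_1},\dots,m_{j_k})$ (with $m_\emptyset=1$), and $v_S=\deg m_S$. The Taylor complex $\mathbf T$ of $Q/I$ has $T_k=\bigoplus_{S\subseteq[r],|S|=k}Q(-v_S)$ with basis elements $\varepsilon_S$, and differential $\tau(\varepsilon_S)=\sum_{i=1}^k(-1)^{k-i}\frac{m_S}{m_{S\setminus\{s_i\}}}\varepsilon_{S\setminus\{s_i\}}$ for $S=\{s_1<\dots<s_k\}$; it is a free resolution of $Q/I$ over $Q$. For $\mathbf u=(u_1,\dots,u_c)\in\mathbb N^c$, $|\mathbf u|=\sum u_i$, $\mathbf e_i$ is the $i$th standard basis vector and $\mathbf 0$ the zero vector. A system of higher homotopies for $a_1,\dots,a_c$ on a complex $\mathbf G$ of free $Q$-modules is a family of $Q$-linear maps $\sigma_{\mathbf u}:\mathbf G\to\mathbf G[-2|\mathbf u|+1]$ (raising homological degree by $2|\mathbf u|-1$), $\mathbf u\in\mathbb N^c$, such that (i) $\sigma_{\mathbf 0}$ is the differential of $\mathbf G$; (ii) for each $j\in[c]$, $\sigma_{\mathbf 0}\sigma_{\mathbf e_j}+\sigma_{\mathbf e_j}\sigma_{\mathbf 0}$ is multiplication by $a_j$;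 (iii) for every $\mathbf u$ with $|\mathbf u|\ge2$, $\sum_{\mathbf b+\mathbf b'=\mathbf u}\sigma_{\mathbf b}\sigma_{\mathbf b'}=0$. Eisenbud–Shamash construction: $\Phi(\mathbf G)=Q\{y_1,\dots,y_c\}\otimes_Q\mathbf G\otimes_Q R$, where $Q\{y_1,\dots,y_c\}$ is the divided power algebra with free basis $y^{(\mathbf u)}=y_1^{(u_1)}\cdots y_c^{(u_c)}$, each $y_i$ of homological degree 2 (so $y^{(\mathbf u)}\otimes g$ has degree $2|\mathbf u|+\deg g$), and the differential is $\varphi=\sum_{\mathbf u}t^{\mathbf u}\otimes\sigma_{\mathbf u}\otimes R$, where $t_j$ acts by $t_j y_j^{(p)}=y_j^{(p-1)}$ (and $t_jy_j^{(0)}=0$). In the present case $\varphi(y^{(\mathbf u)}\otimes\varepsilon_S)=y^{(\mathbf u)}\otimes\tau(\varepsilon_S)+\sum_{i:u_i\ge1}y^{(\mathbf u-\mathbf e_i)}\otimes\sigma_{\mathbf e_i}(\varepsilon_S)$, reduced modulo $\mathfrak a$. *)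

(* Defs.v *)
From HB Require Import structures.
From mathcomp Require Import all_boot all_order all_algebra.
From mathcomp Require Import mpoly.
Set Implicit Arguments. Unset Strict Implicit. Unset Printing Implicit Defensive.
Import Order.TTheory GRing.Theory.
Local Open Scope ring_scope.

Section TaylorES.
Variables (K : fieldType) (n r c : nat).
Local Notation Q := {mpoly K[n]}.

(* A "matrix" of a Q-linear endomorphism of the Taylor complex T (all degrees
   together): M S' S is the coefficient of eps_{S'} in M(eps_S). *)
Definition tmap := {set 'I_r} -> {set 'I_r} -> Q.

Definition tcomp (M N : tmap) : tmap :=
  fun S'' S => \sum_(S' : {set 'I_r}) M S'' S' * N S' S.

Definition mindex := {ffun 'I_c -> nat}.
Definition mabs (u : mindex) : nat := (\sum_(i < c) u i)%N.
Definition mzero : mindex := [ffun => 0%N].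
Definition munit (i : 'I_c) : mindex := [ffun j => nat_of_bool (j == i)].
Definition maddn (u v : mindex) : mindex := [ffun i => (u i + v i)%N].
Definition msubn (u v : mindex) : mindex := [ffun i => (u i - v i)%N].

Definition mlcmS (mm : 'I_r -> 'X_{1..n}) (S : {set 'I_r}) : 'X_{1..n} :=
  \big[@mlcm n/0%MM]_(j in S) mm j.

(* position (1-indexed) of t in the increasingly ordered set S (t in S) *)
Definition pos (t : 'I_r) (S : {set 'I_r}) : nat := #|[set x in S | (x <= t)%N]|.

Definition taylor_diff (mm : 'I_r -> 'X_{1..n}) : tmap :=
  fun S' S => \sum_(s in S) (S' == S :\ s)%:R * (-1) ^+ (#|S| - pos s S)
                 * 'X_[(mlcmS mm S - mlcmS mm S')%MM].

(* sigma_{e_i}(eps_S) = sum_{t notin S} (-1)^(k - p_{t,S} - 1)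
      f_{i,t} m_t m_S / m_{S u {t}} eps_{S u {t}}
   (the sign only depends on the parity of k - p - 1, i.e. of k + p + 1) *)
Definition sigma1 (mm : 'I_r -> 'X_{1..n}) (f : 'I_c -> 'I_r -> Q)
    (i : 'I_c) : tmap :=
  fun S' S => \sum_(t | t \notin S) (S' == t |: S)%:R
                 * (-1) ^+ (#|S| + pos t (t |: S) + 1)
                 * f i t * 'X_[(mm t + mlcmS mm S - mlcmS mm S')%MM].

Definition sigma_fam (mm : 'I_r -> 'X_{1..n}) (f : 'I_c -> 'I_r -> Q)
    (u : mindex) : tmap :=
  match [pick i | u == munit i] with
  | Some i => sigma1 mm f i
  | None => if u == mzero then taylor_diff mm else fun _ _ => 0
  end.

(* System of higher homotopies for a_1..a_c on the complex T with
   differential d (basis eps_S in homological degree #|S|). *)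
Definition higher_homotopies (d : tmap) (a : 'I_c -> Q)
    (sigma : mindex -> tmap) : Prop :=
  (forall u S' S, sigma u S' S != 0 -> (#|S'| + 1 = #|S| + 2 * mabs u)%N) /\
  (forall S' S, sigma mzero S' S = d S' S) /\
  (forall j S' S,
     tcomp (sigma mzero) (sigma (munit j)) S' S
     + tcomp (sigma (munit j)) (sigma mzero) S' S = (S' == S)%:R * a j) /\
  (* (iii) : sum over b + b' = u *)
  (forall u : mindex, (2 <= mabs u)%N -> forall S' S,
     \sum_(b : {ffun 'I_c -> 'I_(mabs u).+1} | [forall i, (b i <= u i)%N])
        tcomp (sigma [ffun i => nat_of_ord (b i)])
              (sigma (msubn u [ffun i => nat_of_ord (b i)])) S' S = 0).

Definition in_ideal (k : nat) (g : 'I_k -> Q) (P : pred 'I_k) (p : Q) : Prop :=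
  exists h : 'I_k -> Q, p = \sum_(j < k | P j) h j * g j.

Definition regular_seq (a : 'I_c -> Q) : Prop :=
  (forall (i : 'I_c) (p : Q),
      in_ideal a (fun j => j < i)%N (a i * p) ->
      in_ideal a (fun j => j < i)%N p) /\
  ~ in_ideal a predT 1.

(* congruence modulo the ideal  a = <a_1..a_c>  (equality in R = Q/a) *)
Definition congr_a (a : 'I_c -> Q) (p q : Q) : Prop := in_ideal a predT (p - q).

(* Elements of the Eisenbud--Shamash complex Phi(T) = Q{y} (x) T (x) R are
   represented by Q-representatives of their coefficients on the basis
   y^(u) (x) eps_S; such an element x lies in Phi_d when it is supported on
   basis elements of degree 2|u| + |S| = d (hence has finite support). *)
Definition esvec := mindex -> {set 'I_r} -> Q.
Definition esdeg (u : mindex) (S : {set 'I_r}) : nat := (2 * mabs u + #|S|)%N.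
Definition in_degree (x : esvec) (d : nat) : Prop :=
  forall u S, x u S != 0 -> esdeg u S = d.

(* The differential phi(y^(u) (x) eps_S) = sum_{v <= u} y^(u-v) (x) sigma_v(eps_S),
   evaluated on an element x of Phi_d: the coefficient of y^(u') (x) eps_{S'}
   is sum_{v, S} sigma_v(S',S) x(u'+v, S); the entries of v are < d+1 for
   x in Phi_d, so the sum is finite. *)
Definition es_diff (sigma : mindex -> tmap) (d : nat) (x : esvec) : esvec :=
  fun u' S' => \sum_(v : {ffun 'I_c -> 'I_d.+1}) \sum_(S : {set 'I_r})
      sigma [ffun i => nat_of_ord (v i)] S' S
      * x (maddn u' [ffun i => nat_of_ord (v i)]) S.

(* Phi(T) is a free resolution of R/I over R (R = Q/a, I = <m_1..m_r>):
   it is a complex over R, exact in positive degrees, and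
   H_0 = Phi_0 / im(phi_1) = R / I R. *)
Definition es_free_resolution (mm : 'I_r -> 'X_{1..n}) (a : 'I_c -> Q)
    (sigma : mindex -> tmap) : Prop :=
  (forall d (x : esvec), in_degree x d.+2 ->
     forall u S, congr_a a (es_diff sigma d.+1 (es_diff sigma d.+2 x) u S) 0) /\
  (forall d (x : esvec), (1 <= d)%N -> in_degree x d ->
     (forall u S, congr_a a (es_diff sigma d x u S) 0) ->
     exists z : esvec, in_degree z d.+1 /\
       forall u S, congr_a a (es_diff sigma d.+1 z u S) (x u S)) /\
  (forall p : Q,
     (exists z : esvec, in_degree z 1 /\
        congr_a a (es_diff sigma 1 z mzero set0) p) <->
     (exists (g : 'I_r -> Q) (h : 'I_c -> Q),
        p = \sum_(j < r) g j * 'X_[mm j] + \sum_(i < c) h i * a i)).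

End TaylorES.

Arguments tcomp {K n r} M N _ _.
Arguments taylor_diff {K n r} mm _ _.
Arguments sigma1 {K n r c} mm f i _ _.
Arguments sigma_fam {K n r c} mm f u _ _.
Arguments higher_homotopies {K n r c} d a sigma.
Arguments regular_seq {K n c} a.
Arguments es_free_resolution {K n r c} mm a sigma.

(* Main.v *)
(* The relations of part (1) are a cancellation of cross terms: deleting s and
   inserting t (or two deletions, or two insertions) in either order gives the
   same monomial with opposite signs, and only the terms inserting and deleting
   the same t survive, contributing f_t m_t each.

   The same relation with f the t-th unit vector reads tau s + s tau = m_t, and
   s is divisible by m_t in the multidegrees divisible by m_t; dividing by m_t
   contracts the Taylor complex there, which gives its exactness.

   For part (2), let phi be the Eisenbud-Shamash map over Q, so that
   phi^2 = sum_j a_j t_j. By induction on k, every cycle modulo a_1, ..., a_k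
   that only involves y_1, ..., y_k is a boundary modulo a_1, ..., a_k. *)

Require Import Defs.
From HB Require Import structures.
From mathcomp Require Import all_boot all_order all_algebra.
From mathcomp Require Import mpoly.
From mathcomp Require Import ring zify.
Import Order.TTheory GRing.Theory.
Local Open Scope ring_scope.

Set Implicit Arguments.
Unset Strict Implicit.

(** The terms at (t, u) and (u, t) cancel. Splitting at u < t avoids any division by 2, so
    characteristic 2 is covered. *)
Lemma sum_antisym (V : zmodType) (r : nat) (P : pred 'I_r) (F : 'I_r -> 'I_r -> V) :
  (forall t u, t != u -> P t -> P u -> F u t = - F t u) ->
  \sum_(t | P t) \sum_(u | P u && (u != t)) F t u = 0.
Proof.
move=> aF.
have -> : \sum_(t | P t) \sum_(u | P u && (u != t)) F t u =
   \sum_(t | P t) \sum_(u | P u && (u < t)%N) F t u +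
   \sum_(t | P t) \sum_(u | P u && (t < u)%N) F t u.
  rewrite -big_split; apply: eq_bigr => t _ /=.
  rewrite (bigID (fun u : 'I_r => (u < t)%N)) /=; congr (_ + _); apply: eq_bigl => u.
    by rewrite -(inj_eq val_inj) neq_ltn /=; case: (P u); case: ltngtP.
  by rewrite -(inj_eq val_inj) neq_ltn /=; case: (P u); case: ltngtP.
rewrite [X in _ + X](exchange_big_dep P) /=; last by move=> i j _ /andP[].
rewrite -big_split big1 // => t Pt /=.
rewrite -[X in _ + X]opprK -sumrN.
apply/eqP; rewrite subr_eq0; apply/eqP.
apply: eq_big => u; first by rewrite Pt andbC; case: (P u).
by case/andP=> Pu lt_ut; apply: aF; rewrite // -(inj_eq val_inj) neq_ltn /= ?lt_ut.
Qed.

(** * The relations between the Taylor differential and the homotopies *)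

Section Lcm.
Variables (n r : nat) (mm : 'I_r -> 'X_{1..n}).
Implicit Types (S : {set 'I_r}) (t : 'I_r).

Lemma mlcmS_leP S (m : 'X_{1..n}) :
  reflect (forall j, j \in S -> (mm j <= m)%MM) (mlcmS mm S <= m)%MM.
Proof.
have -> : (mlcmS mm S <= m)%MM = \big[andb/true]_(j in S) (mm j <= m)%MM.
  apply: (big_morph (fun x => (x <= m)%MM)) => [x y|]; first exact: lem_mlcm.
  by apply/mnm_lepP => i; rewrite mnm0E.
by rewrite big_andE; apply: (iffP forall_inP).
Qed.

Lemma mnm_le_mlcmS S t : t \in S -> (mm t <= mlcmS mm S)%MM.
Proof. by apply/mlcmS_leP; apply: lepm_refl. Qed.

Lemma mlcmS_sub S S' : S \subset S' -> (mlcmS mm S <= mlcmS mm S')%MM.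
Proof. by move/subsetP=> sSS'; apply/mlcmS_leP => j /sSS'; apply: mnm_le_mlcmS. Qed.

Lemma mlcmSU1_le S t (m : 'X_{1..n}) :
  (mlcmS mm (t |: S) <= m)%MM = (mm t <= m)%MM && (mlcmS mm S <= m)%MM.
Proof.
apply/mlcmS_leP/andP => [h|[ht /mlcmS_leP hS] j].
  by split; [apply: h; rewrite setU11 | apply/mlcmS_leP => j jS; apply: h; rewrite setU1r].
by case/setU1P=> [->|/hS].
Qed.

Lemma mlcmSU1_leD S t : (mlcmS mm (t |: S) <= mm t + mlcmS mm S)%MM.
Proof. by rewrite mlcmSU1_le lem_addr lem_addl. Qed.

End Lcm.

(** * Signs, coefficients and the quadratic relations *)

Section Maps.
Variables (K : fieldType) (n r : nat) (mm : 'I_r -> 'X_{1..n}).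
Local Notation Q := {mpoly K[n]}.
Implicit Types (S : {set 'I_r}) (t s : 'I_r) (g h : 'I_r -> Q).
Local Notation m_ S := (mlcmS mm S).

(** The number of elements of [S] above [t] has the parity of k - p for a deletion and of k - p - 1
    for an insertion, so one sign serves both maps; it does not depend on whether [t] lies in
    [S]. *)
Definition sgn t S : Q := (-1) ^+ #|[set x in S | (t < x)%N]|.

Definition dcoef s S : Q := sgn s S * 'X_[(m_ S - m_ (S :\ s))%MM].
Definition hcoef g t S : Q := sgn t S * g t * 'X_[(mm t + m_ S - m_ (t |: S))%MM].

(* The map [sigma_{e_i}], for arbitrary coefficients: besides the rows of [f],
   unit vectors are used to show that the Taylor complex is exact. *)
Definition thomotopy g : tmap K n r :=
  fun S' S => \sum_(t | t \notin S) (S' == t |: S)%:R * hcoef g t S.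

Lemma sgnU1 t s S : s \notin S -> sgn t (s |: S) = sgn t S * (-1) ^+ (t < s)%N.
Proof.
move=> sS; rewrite /sgn; case: (boolP (t < s)%N) => ts.
  have -> : [set x in s |: S | (t < x)%N] = s |: [set x in S | (t < x)%N].
    by apply/setP=> x; rewrite !inE; case: eqP => // ->; rewrite ts.
  by rewrite cardsU1 inE (negPf sS) exprD mulrC.
have -> : [set x in s |: S | (t < x)%N] = [set x in S | (t < x)%N].
  by apply/setP=> x; rewrite !inE; case: eqP => // ->; rewrite (negPf ts) !andbF.
by rewrite mulr1.
Qed.

Lemma sgn_self t S : sgn t (t |: S) = sgn t S.
Proof.
rewrite /sgn; congr (_ ^+ _); apply: eq_card => x; rewrite !inE.
by case: eqP => // ->; rewrite ltnn !andbF.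
Qed.

Lemma sgn_sqr t S : sgn t S * sgn t S = 1.
Proof. by rewrite /sgn -exprMn mulN1r opprK expr1n. Qed.

Lemma pos_sgn t S : t \in S -> (#|S| = pos t S + #|[set x in S | (t < x)%N]|)%N.
Proof.
move=> tS; rewrite -(cardsID [set x : 'I_r | (x <= t)%N] S) /pos; congr (_ + _)%N.
  by apply: eq_card => x; rewrite !inE.
by apply: eq_card => x; rewrite !inE -ltnNge andbC.
Qed.

Lemma taylor_diffE S' S :
  taylor_diff mm S' S = \sum_(s in S) (S' == S :\ s)%:R * dcoef s S.
Proof.
apply: eq_bigr => s sS; rewrite (pos_sgn sS) addKn.
by case: eqP => [->|_]; rewrite ?mul0r // !mul1r.
Qed.

Lemma sigma1E c (f : 'I_c -> 'I_r -> Q) i S' S :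
  sigma1 mm f i S' S = thomotopy (f i) S' S.
Proof.
apply: eq_bigr => t tS; case: eqP => [->|_]; rewrite ?mul0r // !mul1r.
congr (_ * _ * _).
have tU : t \in t |: S by rewrite setU11.
move: (pos_sgn tU) (sgn_self t S); rewrite cardsU1 tS add1n /sgn => cU <-.
by rewrite addn1 -addSn cU addnAC exprD addnn -muln2 exprM sqrr_sign mul1r.
Qed.

Lemma tcomp_thomotopy (M : tmap K n r) g S' S :
  tcomp M (thomotopy g) S' S = \sum_(t | t \notin S) M S' (t |: S) * hcoef g t S.
Proof.
rewrite /tcomp /thomotopy; under eq_bigr do rewrite mulr_sumr.
rewrite exchange_big; apply: eq_bigr => t tS /=.
rewrite (bigD1 (t |: S)) //= eqxx mul1r big1 ?addr0 // => X /negPf ->.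
by rewrite mul0r mulr0.
Qed.

Lemma tcomp_taylor (M : tmap K n r) S' S :
  tcomp M (taylor_diff mm) S' S = \sum_(s in S) M S' (S :\ s) * dcoef s S.
Proof.
rewrite /tcomp; under eq_bigr do rewrite taylor_diffE mulr_sumr.
rewrite exchange_big; apply: eq_bigr => s sS /=.
rewrite (bigD1 (S :\ s)) //= eqxx mul1r big1 ?addr0 // => X /negPf ->.
by rewrite mul0r mulr0.
Qed.

(** Subtraction of exponents is truncated; the two divisibilities make it exact. *)
Lemma monoX_telescope (p q s : 'X_{1..n}) :
  (q <= p)%MM -> (s <= q)%MM -> 'X_[p - q] * 'X_[q - s] = 'X_[p - s] :> Q.
Proof.
move=> /mnm_lepP qp /mnm_lepP sq; rewrite -mpolyXD; congr ('X_[_]).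
apply/mnmP => i; rewrite !mnmE; move: (qp i) (sq i); lia.
Qed.

Lemma monoX_telescope_add (p q s t : 'X_{1..n}) :
  (q <= p)%MM -> (s <= t + q)%MM ->
  'X_[p - q] * 'X_[t + q - s] = 'X_[t + p - s] :> Q.
Proof.
move=> /mnm_lepP qp /mnm_lepP sq; rewrite -mpolyXD; congr ('X_[_]).
apply/mnmP => i; rewrite !mnmE; move: (qp i) (sq i); rewrite !mnmE; lia.
Qed.

Lemma neq_sign (s t : 'I_r) : s != t -> (-1) ^+ (s < t)%N = - (-1) ^+ (t < s)%N :> Q.
Proof.
by rewrite -(inj_eq val_inj) /=; case: ltngtP => // _ _; rewrite ?opprK.
Qed.

Lemma taylor_taylor S' S : tcomp (taylor_diff mm) (taylor_diff mm) S' S = 0 :> Q.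
Proof.
rewrite tcomp_taylor.
pose F s t : Q := (S' == S :\ s :\ t)%:R * dcoef t (S :\ s) * dcoef s S.
transitivity (\sum_(s in S) \sum_(t | (t \in S) && (t != s)) F s t).
  apply: eq_bigr => s sS; rewrite taylor_diffE mulr_suml.
  by apply: eq_bigl => t; rewrite !inE andbC.
apply: sum_antisym => s t st sS tS; rewrite /F.
rewrite [S :\ t :\ s]setDDl setUC -setDDl.
case: eqP => _; rewrite ?mul0r ?oppr0 // !mul1r.
(* Apart from the factor (-1)^(x < y), this form of the coefficient is symmetric in [x] and [y]. *)
have E x y : x != y -> x \in S -> y \in S ->
   dcoef y (S :\ x) * dcoef x S =
   sgn y (S :\ x :\ y) * sgn x (S :\ x :\ y) * (-1) ^+ (x < y)%N
     * 'X_[m_ S - m_ (S :\ x :\ y)].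
  move=> xy xS yS; rewrite /dcoef.
  have yx : y \in S :\ x by rewrite !inE eq_sym xy.
  have e1 : sgn y (S :\ x) = sgn y (S :\ x :\ y).
    by rewrite -[in LHS](setD1K yx) sgn_self.
  have e2 : sgn x S = sgn x (S :\ x :\ y) * (-1) ^+ (x < y)%N.
    rewrite -[in LHS](setD1K xS) sgn_self -[in LHS](setD1K yx) sgnU1 //.
    by rewrite !inE eqxx.
  rewrite e1 e2.
  rewrite -(@monoX_telescope (m_ S) (m_ (S :\ x)) (m_ (S :\ x :\ y))) ?mlcmS_sub ?subsetDl //.
  by ring.
rewrite !E //; last by rewrite eq_sym.
rewrite (neq_sign st) [S :\ t :\ s]setDDl [[set t] :|: _]setUC -setDDl.
by ring.
Qed.

(** The order of the two insertions only affects the sign comparing [t] and [u]. Two coefficient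
    families are allowed so that squares and anticommutators are both covered. *)
Lemma thomotopy_term g h t u S S' : t != u -> t \notin S -> u \notin S ->
  (S' == u |: (t |: S))%:R * hcoef g u (t |: S) * hcoef h t S
  = - ((S' == t |: (u |: S))%:R * hcoef h t (u |: S) * hcoef g u S).
Proof.
move=> tu tS uS; rewrite [t |: (u |: S)]setUCA.
case: eqP => _; rewrite ?mul0r ?oppr0 // !mul1r.
have E x y a b : x \notin S ->
   hcoef a y (x |: S) * hcoef b x S =
   sgn y S * sgn x S * (-1) ^+ (y < x)%N * a y * b x
     * 'X_[mm y + (mm x + m_ S) - m_ (y |: (x |: S))].
  move=> xS; rewrite /hcoef sgnU1 //.
  rewrite -(@monoX_telescope_add (mm x + m_ S) (m_ (x |: S)) (m_ (y |: (x |: S)))) ?mlcmSU1_leD //.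
  by ring.
rewrite !E // [t |: (u |: S)]setUCA (neq_sign tu) addmA [(mm u + mm t)%MM]addmC -addmA.
by ring.
Qed.

Lemma thomotopy_sum g h S' S :
  tcomp (thomotopy g) (thomotopy h) S' S =
  \sum_(t | t \notin S) \sum_(u | (u \notin S) && (u != t))
     (S' == u |: (t |: S))%:R * hcoef g u (t |: S) * hcoef h t S.
Proof.
rewrite tcomp_thomotopy; apply: eq_bigr => t tS; rewrite mulr_suml.
by apply: eq_bigl => u; rewrite !inE negb_or andbC.
Qed.

(** Proved apart from the anticommutator, whose case g = h gives only twice the square and says
    nothing in characteristic 2. *)
Lemma thomotopy_sqr g S' S : tcomp (thomotopy g) (thomotopy g) S' S = 0.
Proof.
rewrite thomotopy_sum; apply: (@sum_antisym _ _ (fun t => t \notin S)) => t u tu tS uS.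
by apply: thomotopy_term; rewrite // eq_sym.
Qed.

Lemma thomotopy_anticomm g h S' S :
  tcomp (thomotopy g) (thomotopy h) S' S + tcomp (thomotopy h) (thomotopy g) S' S = 0.
Proof.
rewrite !thomotopy_sum -big_split; under eq_bigr do rewrite -big_split /=.
apply: (@sum_antisym _ _ (fun t => t \notin S)) => t u tu tS uS /=.
have ut : u != t by rewrite eq_sym.
by rewrite opprD [RHS]addrC; congr (_ + _); apply: thomotopy_term.
Qed.

Lemma thomotopy_taylor g S' S :
  tcomp (taylor_diff mm) (thomotopy g) S' S + tcomp (thomotopy g) (taylor_diff mm) S' S
  = (S' == S)%:R * \sum_j g j * 'X_[mm j].
Proof.
rewrite tcomp_taylor tcomp_thomotopy.
(* Inserting and deleting the same index yields [D]: indices outside [S] come from the first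
   composite, those in [S] from the second. [C] holds the cross terms of the first composite. *)
pose D t : Q := (S' == S)%:R * (g t * 'X_[mm t]).
pose C t s : Q := (S' == (t |: S) :\ s)%:R * dcoef s (t |: S) * hcoef g t S.
have -> : \sum_(t | t \notin S) taylor_diff mm S' (t |: S) * hcoef g t S =
   \sum_(t | t \notin S) D t + \sum_(t | t \notin S) \sum_(s in S) C t s.
  rewrite -big_split; apply: eq_bigr => t tS /=.
  rewrite taylor_diffE big_setU1 //= mulrDl mulr_suml; congr (_ + _).
  rewrite setU1K // /D; case: eqP => _; rewrite ?mul0r // !mul1r.
  rewrite /dcoef /hcoef sgn_self setU1K //.
  transitivity ((sgn t S * sgn t S) * g t *
    ('X_[mm t + m_ S - m_ (t |: S)] * 'X_[m_ (t |: S) - m_ S])); first by ring.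
  rewrite sgn_sqr mul1r monoX_telescope ?mlcmSU1_leD ?mlcmS_sub ?subsetUr //.
  by rewrite addmK.
have -> : \sum_(s in S) thomotopy g S' (S :\ s) * dcoef s S =
   \sum_(s in S) D s + \sum_(s in S) \sum_(t | t \notin S) - C t s.
  rewrite -big_split; apply: eq_bigr => s sS /=.
  rewrite /thomotopy (bigD1 s) /=; last by rewrite !inE eqxx.
  rewrite mulrDl mulr_suml; congr (_ + _).
    rewrite setD1K // /D; case: eqP => _; rewrite ?mul0r // !mul1r.
    rewrite /dcoef /hcoef setD1K // -[in sgn s S](setD1K sS) sgn_self.
    transitivity ((sgn s (S :\ s) * sgn s (S :\ s)) * g s *
      ('X_[m_ S - m_ (S :\ s)] * 'X_[mm s + m_ (S :\ s) - m_ S])); first by ring.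
    rewrite sgn_sqr mul1r monoX_telescope_add ?mlcmS_sub ?subsetDl //.
      by rewrite addmK.
    by rewrite -[in m_ S](setD1K sS) mlcmSU1_leD.
  apply: eq_big => t.
    by rewrite !inE; case: eqP => [->|_] /=; rewrite ?sS ?andbT.
  case/andP=> tS ts.
  have {}tS : t \notin S by move: tS; rewrite !inE ts.
  have e : (t |: S) :\ s = t |: (S :\ s).
    apply/setP=> x; rewrite !inE; case: (x =P t) => [->|_] //=.
    by rewrite ts.
  rewrite /C e; case: eqP => _; rewrite ?mul0r ?oppr0 // !mul1r.
  have sUS : s |: (t |: (S :\ s)) = t |: S by rewrite setUCA setD1K.
  have s0 : s \notin t |: (S :\ s) by rewrite !inE eq_sym (negPf ts) eqxx.
  have s1 : s \notin S :\ s by rewrite !inE eqxx.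
  have t1 : t \notin S :\ s by rewrite !inE negb_and tS orbT.
  rewrite /dcoef /hcoef e.
  have -> : sgn s (t |: S) = sgn s (S :\ s) * (-1) ^+ (s < t)%N.
    by rewrite -sUS sgn_self sgnU1.
  have -> : sgn t S = sgn t (S :\ s) * (-1) ^+ (t < s)%N.
    by rewrite -[in LHS](setD1K sS) sgnU1.
  have -> : sgn s S = sgn s (S :\ s) by rewrite -[in LHS](setD1K sS) sgn_self.
  have st : s != t by rewrite eq_sym.
  rewrite (neq_sign st).
  transitivity (sgn t (S :\ s) * g t * sgn s (S :\ s) *
     ('X_[m_ S - m_ (S :\ s)] * 'X_[(mm t + m_ (S :\ s) - m_ (t |: S :\ s))])).
    by ring.
  rewrite monoX_telescope_add ?mlcmS_sub ?subsetDl ?mlcmSU1_leD //.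
  rewrite -(@monoX_telescope (mm t + m_ S) (m_ (t |: S)) (m_ (t |: (S :\ s)))) ?mlcmSU1_leD //; last first.
    by rewrite mlcmS_sub // -e subsetDl.
  (* The two comparison signs on the right are opposite, so their product is minus a square; that
     square, equal to 1, is inserted on the left for [ring] to match. *)
  rewrite -[LHS]mulr1 -[X in _ * X = _](sqrr_sign _ (t < s)%N) expr2.
  by ring.
rewrite [X in _ + X + _]exchange_big /=.
under [X in _ + (_ + X)]eq_bigr do rewrite sumrN.
rewrite sumrN addrACA subrr addr0 mulr_sumr [RHS](bigID (mem S)) /= addrC.
by [].
Qed.

End Maps.

(** * Exactness of the Taylor complex *)

Section MonomialFilter.
Variables (K : fieldType) (n : nat).
Local Notation Q := {mpoly K[n]}.
Implicit Types (p q : Q) (E : pred 'X_{1..n}).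

(** Projection onto the span of the monomials in [E]. It is not [Q]-linear: multiplying by a
    monomial shifts [E]. *)
Definition mfilter E p : Q := \sum_(m <- msupp p | E m) p@_m *: 'X_[m].

Lemma mfilterE E p m : (mfilter E p)@_m = if E m then p@_m else 0.
Proof.
rewrite /mfilter raddf_sum /=.
under eq_bigr do rewrite mcoeffZ mcoeffX.
case: (boolP (m \in msupp p)) => mp; last first.
  rewrite big1_seq; first by rewrite (memN_msupp_eq0 mp) if_same.
  move=> k /andP[_ kp]; case: eqP => [e|_]; last by rewrite mulr0.
  by rewrite -e kp in mp.
rewrite big_mkcond (bigD1_seq m) //= eqxx mulr1 big1 ?addr0 // => k /negPf ->.
by rewrite mulr0 if_same.
Qed.

Lemma mfilter_sum E (I : Type) (s : seq I) (P : pred I) (F : I -> Q) :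
  mfilter E (\sum_(i <- s | P i) F i) = \sum_(i <- s | P i) mfilter E (F i).
Proof.
apply/mpolyP => m; rewrite mfilterE !raddf_sum /=.
under [RHS]eq_bigr do rewrite mfilterE.
by case: (E m) => //; rewrite big1.
Qed.

Lemma mfilter0 E : mfilter E 0 = 0.
Proof. by apply/mpolyP => m; rewrite mfilterE mcoeff0 if_same. Qed.

Lemma mcoeffMX_eq0 p m k : ~~ (m <= k)%MM -> (p * 'X_[m])@_k = 0.
Proof.
move=> mk; rewrite [p]mpolyE mulr_suml raddf_sum big1 //= => j _.
rewrite -scalerAl -mpolyXD mcoeffZ mcoeffX; case: eqP => [e|_]; last exact: mulr0.
by rewrite -e lem_addl in mk.
Qed.

Lemma mfilterMX E p m :
  mfilter E (p * 'X_[m]) = mfilter (fun k => E (k + m)%MM) p * 'X_[m].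
Proof.
apply/mpolyP => k; rewrite mfilterE.
case: (boolP (m <= k)%MM) => mk; last by rewrite !mcoeffMX_eq0 // if_same.
by rewrite -(submK mk) [(_ + m)%MM]addmC !mcoeffMX mfilterE addmC.
Qed.

Lemma mfilter_sign E (b : nat) p : mfilter E ((-1) ^+ b * p) = (-1) ^+ b * mfilter E p.
Proof.
rewrite -signr_odd; case: (odd b); rewrite ?mul1r // !mulN1r.
by apply/mpolyP => m; rewrite mcoeffN !mfilterE mcoeffN; case: (E m); rewrite ?oppr0.
Qed.

Lemma mpoly_divX p m :
  (forall k, p@_k != 0 -> (m <= k)%MM) -> exists q : Q, p = 'X_[m] * q.
Proof.
move=> pm; exists (\sum_(k <- msupp p) p@_k *: 'X_[k - m]).
rewrite [p in LHS]mpolyE mulr_sumr; apply: eq_big_seq => k kp.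
by rewrite -scalerAr -mpolyXD addmC submK // pm // -mcoeff_msupp.
Qed.

Lemma mpolyX_neq0 (m : 'X_{1..n}) : 'X_[m] != 0 :> Q.
Proof. by apply/eqP => /(congr1 (mcoeff m)) /eqP; rewrite mcoeffX mcoeff0 eqxx oner_eq0. Qed.

End MonomialFilter.

(** * Multigraded pieces and their contraction *)

Section TaylorExact.
Variables (K : fieldType) (n r : nat) (mm : 'I_r -> 'X_{1..n}).
Local Notation Q := {mpoly K[n]}.
Implicit Types (S : {set 'I_r}) (t s : 'I_r) (x : {set 'I_r} -> Q) (M : tmap K n r).
Local Notation m_ S := (mlcmS mm S).

Definition tapp M x : {set 'I_r} -> Q := fun S' => \sum_S M S' S * x S.

Lemma tapp_comp M N x S : tapp M (tapp N x) S = tapp (tcomp M N) x S.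
Proof.
rewrite /tapp /tcomp; under eq_bigr do rewrite mulr_sumr.
rewrite exchange_big; apply: eq_bigr => S' _ /=; rewrite mulr_suml.
by apply: eq_bigr => S'' _; rewrite mulrA.
Qed.

Lemma eq_tapp M (N : tmap K n r) x x' : (forall S' S, M S' S = N S' S) -> x =1 x' -> tapp M x =1 tapp N x'.
Proof. by move=> e e' S; apply: eq_bigr => S' _; rewrite e e'. Qed.

Lemma tappZ M (p : Q) x S : tapp M (fun S' => p * x S') S = p * tapp M x S.
Proof. by rewrite /tapp mulr_sumr; apply: eq_bigr => S' _; rewrite mulrCA. Qed.

Lemma tapp_sum M (I : finType) (F : I -> {set 'I_r} -> Q) S :
  tapp M (fun S' => \sum_i F i S') S = \sum_i tapp M (F i) S.
Proof. by rewrite /tapp exchange_big; apply: eq_bigr => S' _; rewrite mulr_sumr. Qed.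

Lemma tappD M (g h : {set 'I_r} -> Q) S :
  tapp M (fun S => g S + h S) S = tapp M g S + tapp M h S.
Proof. by rewrite /tapp -big_split; apply: eq_bigr => S' _; rewrite mulrDr. Qed.

Lemma tappB M (g h : {set 'I_r} -> Q) S :
  tapp M (fun S => g S - h S) S = tapp M g S - tapp M h S.
Proof. by rewrite /tapp -sumrB; apply: eq_bigr => S' _; rewrite mulrBr. Qed.

Lemma tapp_eq0 M x S : (forall S' S, M S' S = 0) -> tapp M x S = 0.
Proof. by move=> M0; rewrite /tapp big1 // => S' _; rewrite M0 mul0r. Qed.

Lemma taylor_diff_degree S' S : taylor_diff mm S' S != 0 :> Q -> #|S| = #|S'|.+1.
Proof.
rewrite taylor_diffE; apply: contraNeq => ne; rewrite big1 // => s sS.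
by case: eqP => [e|_]; rewrite ?mul0r //; move: ne; rewrite e (cardsD1 s S) sS eqxx.
Qed.

Lemma thomotopy_degree g S' S : thomotopy mm g S' S != 0 :> Q -> #|S'| = #|S|.+1.
Proof.
apply: contraNeq => ne; rewrite /thomotopy big1 // => s sS.
by case: eqP => [e|_]; rewrite ?mul0r //; move: ne; rewrite e cardsU1 sS add1n eqxx.
Qed.

(* [eps_S] has multidegree [m_S]. *)
Definition tfilter (E : pred 'X_{1..n}) x : {set 'I_r} -> Q :=
  fun S => mfilter (fun k => E (k + m_ S)%MM) (x S).

(** The Taylor differential preserves multidegrees: the factor m_S / m_(S - s) makes up for
    replacing the basis degree m_S by m_(S - s). *)
Lemma tfilter_taylor E x S :
  tapp (taylor_diff mm) (tfilter E x) S = tfilter E (tapp (taylor_diff mm) x) S.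
Proof.
rewrite /tfilter /tapp mfilter_sum; apply: eq_bigr => S' _.
rewrite !taylor_diffE !mulr_suml mfilter_sum; apply: eq_bigr => s sS.
case: eqP => [->|_]; rewrite ?mul0r ?mfilter0 // !mul1r /dcoef.
rewrite -!mulrA mfilter_sign; congr (_ * _).
rewrite mulrC [_ * x S']mulrC mfilterMX; congr (_ * _).
apply/mpolyP => k; rewrite !mfilterE -addmA submK //.
by rewrite mlcmS_sub ?subsetDl.
Qed.

(* On multidegrees divisible by [m_t], the homotopy attached to the t-th unit
   vector is divisible by [m_t] and the quotient contracts the Taylor complex. *)
Lemma taylor_contract t N x :
  (forall S, x S != 0 -> #|S| = N) ->
  (forall S k, (x S)@_k != 0 -> (mm t <= k + m_ S)%MM) ->
  (forall S, tapp (taylor_diff mm) x S = 0) ->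
  exists z, (forall S, z S != 0 -> #|S| = N.+1) /\
    forall S, tapp (taylor_diff mm) z S = x S.
Proof.
move=> xN xt tx0.
pose g j : Q := (j == t)%:R.
have div S : exists q, tapp (thomotopy mm g) x S = 'X_[mm t] * q.
  apply: mpoly_divX => k; rewrite /tapp raddf_sum /= => ne.
  case: (boolP (mm t <= k)%MM) => // tk; move/eqP: ne; case.
  apply: big1 => S' _; rewrite /thomotopy mulr_suml raddf_sum big1 //= => j jS'.
  case: eqP => [e|_]; rewrite ?mul0r ?mcoeff0 // mul1r /hcoef /g.
  case: (j =P t) => [ej|_]; last by rewrite mulr0 !mul0r mcoeff0.
  rewrite mulr1 /sgn -mulrA -signr_odd.
  suff h : ('X_[mm j + m_ S' - m_ (j |: S')] * x S')@_k = 0.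
    by case: (odd _); rewrite ?mul1r // mulN1r mcoeffN h oppr0.
  rewrite mulrC; set d := (_ - _)%MM; case: (boolP (d <= k)%MM) => dk; last exact: mcoeffMX_eq0.
  rewrite -(submK dk) addmC mcoeffMX; apply/eqP; apply: contraNT tk => /xt h.
  (* Both m_t and m_S' divide this multidegree, hence so does their lcm; removing m_S' and restoring
     [d] leaves a multiple of m_t. *)
  have {}h : (m_ (t |: S') <= k - d + m_ S')%MM by rewrite mlcmSU1_le h lem_addl.
  move: dk h (mlcmSU1_leD mm S' t); rewrite /d ej.
  move=> /mnm_lepP a1 /mnm_lepP a2 /mnm_lepP a3; apply/mnm_lepP => i.
  move: (a1 i) (a2 i) (a3 i); rewrite !(mnmDE, mnmBE); lia.
have [z0 z0E] := fin_all_exists div.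
have Xcan (p q : Q) : 'X_[mm t] * p = 'X_[mm t] * q -> p = q.
  by apply: mulfI; apply: mpolyX_neq0.
exists z0; split=> S.
  apply: contraNeq => SN; apply/eqP/Xcan; rewrite -z0E mulr0 /tapp big1 // => S' _.
  have [-> | /xN S'N] := eqVneq (x S') 0; first exact: mulr0.
  have [->| /thomotopy_degree] := eqVneq (thomotopy mm g S S') 0; first exact: mul0r.
  by rewrite S'N => e; rewrite e eqxx in SN.
apply: Xcan; rewrite -tappZ.
rewrite -(eq_tapp (fun _ _ => erefl) z0E) tapp_comp.
(* The added composite vanishes because [x] is a cycle; with it, the sum is multiplication by
   m_t. *)
have -> : tapp (tcomp (taylor_diff mm) (thomotopy mm g)) x S =
  tapp (tcomp (taylor_diff mm) (thomotopy mm g)) x S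
  + tapp (tcomp (thomotopy mm g) (taylor_diff mm)) x S.
  rewrite -[X in _ + X]tapp_comp [X in _ + X]/tapp [X in _ + X]big1 ?addr0 // => S' _.
  by rewrite tx0 mulr0.
rewrite /tapp -big_split /=; under eq_bigr do rewrite -mulrDl thomotopy_taylor.
have off S' : S' != S -> (S == S')%:R * (\sum_j g j * 'X_[mm j]) * x S' = 0.
  by rewrite eq_sym => /negPf->; rewrite !mul0r.
rewrite (bigD1 S) //= [X in _ + X]big1 // addr0 eqxx mul1r.
by rewrite (bigD1 t) //= big1 ?addr0 /g ?eqxx ?mul1r // => j /negPf ->; rewrite mul0r.
Qed.

(** The cycle is cut into pieces by assigning each multidegree to a single generator dividing it,
    and each piece is contracted separately. *)
Lemma taylor_exact N x :
  (0 < N)%N -> (forall S, x S != 0 -> #|S| = N) ->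
  (forall S, tapp (taylor_diff mm) x S = 0) ->
  exists z, (forall S, z S != 0 -> #|S| = N.+1) /\
    forall S, tapp (taylor_diff mm) z S = x S.
Proof.
move=> N0 xN tx0.
pose E t (k : 'X_{1..n}) := [pick j | (mm j <= k)%MM] == Some t.
have ex t : exists z, (forall S, z S != 0 -> #|S| = N.+1) /\
    forall S, tapp (taylor_diff mm) z S = tfilter (E t) x S.
  apply: (@taylor_contract t) => [S|S k|S].
  - move=> ne; apply: xN; apply: contraNneq ne => e.
    by rewrite /tfilter e mfilter0.
  - rewrite /tfilter mfilterE /E; case: pickP => [j jk|_]; last by rewrite eqxx.
    by case: (Some j =P Some t) => [[<-] _ //|_]; rewrite eqxx.
  - by rewrite tfilter_taylor /tfilter tx0 mfilter0.
have [z zP] := fin_all_exists ex.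
exists (fun S => \sum_t z t S); split => S.
  apply: contraNeq => SN; rewrite big1 // => t _; apply/eqP.
  by apply: contraNT SN => /(proj1 (zP t)) ->.
rewrite tapp_sum; under eq_bigr do rewrite (proj2 (zP _)).
have [x0|/xN SN] := eqVneq (x S) 0.
  by rewrite x0 big1 // => t _; rewrite /tfilter x0 mfilter0.
apply/mpolyP => k; rewrite raddf_sum /=.
under eq_bigr do rewrite mfilterE /E.
case: pickP => [j jk|no].
  rewrite (bigD1 j) //= eqxx big1 ?addr0 // => t tj.
  by case: eqP => // -[e]; rewrite e eqxx in tj.
(* Positive degree enters here: a nonempty [S] contains some [j], and m_j divides m_S, so every
   multidegree of [x] is assigned to a generator. *)
have /card_gt0P[j jS] : (0 < #|S|)%N by rewrite SN.
have := no j; rewrite (lepm_trans (mnm_le_mlcmS mm jS)) ?lem_addl //.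
Qed.

End TaylorExact.

Lemma sum_alternating (V : zmodType) (c : nat) (F : 'I_c -> 'I_c -> V) :
  (forall i, F i i = 0) -> (forall i j, i != j -> F j i = - F i j) ->
  \sum_i \sum_j F i j = 0.
Proof.
move=> F0 FN; rewrite -[RHS](@sum_antisym _ _ xpredT F) => [|i j ij _ _].
  by apply: eq_bigr => i _; rewrite (bigD1 i) //= F0 add0r.
by rewrite (FN _ _ ij).
Qed.

Lemma sum_neq0 (V : zmodType) (I : finType) (F : I -> V) :
  \sum_i F i != 0 -> exists i, F i != 0.
Proof.
move=> ne; apply/existsP; apply: contraNT ne; rewrite negb_exists => /forallP F0.
by rewrite big1 // => i _; apply/eqP; move: (F0 i); rewrite negbK.
Qed.

(** * The Eisenbud-Shamash complex *)

Section MultiIndex.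
Variable c : nat.
Implicit Types u v : mindex c.

Lemma maddnA u v w : maddn (maddn u v) w = maddn u (maddn v w).
Proof. by apply/ffunP => i; rewrite !ffunE addnA. Qed.

Lemma maddnC u v : maddn u v = maddn v u.
Proof. by apply/ffunP => i; rewrite !ffunE addnC. Qed.

Lemma maddn0 u : maddn u (mzero c) = u.
Proof. by apply/ffunP => i; rewrite !ffunE addn0. Qed.

Lemma munitE (i j : 'I_c) : munit i j = (j == i) :> nat.
Proof. by rewrite ffunE. Qed.

Lemma munit_inj : injective (@munit c).
Proof. by move=> i j /ffunP/(_ i); rewrite !munitE eqxx; case: eqP. Qed.

Lemma munit_neq0 i : munit i == mzero c = false.
Proof. by apply/eqP => /ffunP/(_ i); rewrite munitE ffunE eqxx. Qed.

Lemma maddn_munit_neq0 u i : maddn u (munit i) == mzero c = false.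
Proof. by apply/eqP => /ffunP/(_ i); rewrite !ffunE eqxx addn1. Qed.

Lemma mabsD u v : mabs (maddn u v) = (mabs u + mabs v)%N.
Proof. by rewrite /mabs -big_split; apply: eq_bigr => i _; rewrite ffunE. Qed.

Lemma mabs_mzero : mabs (mzero c) = 0%N.
Proof. by rewrite /mabs big1 // => i _; rewrite ffunE. Qed.

Lemma mabs_munit (i : 'I_c) : mabs (munit i) = 1%N.
Proof.
rewrite /mabs (bigD1 i) //= munitE eqxx big1 // => j /negPf ji.
by rewrite munitE ji.
Qed.

Lemma leq_mabs u i : (u i <= mabs u)%N.
Proof. by rewrite /mabs (bigD1 i) //= leq_addr. Qed.

Lemma msubnK u i : u i != 0%N -> maddn (msubn u (munit i)) (munit i) = u.
Proof.
move=> ui; apply/ffunP => j; rewrite !ffunE.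
by case: (j =P i) => [->|_] /=; rewrite ?subn0 ?addn0 // subnK // lt0n.
Qed.

Lemma maddnK u v : msubn (maddn u v) v = u.
Proof. by apply/ffunP => j; rewrite !ffunE addnK. Qed.

Definition mindex_of d (v : {ffun 'I_c -> 'I_d.+1}) : mindex c :=
  [ffun i => nat_of_ord (v i)].

(** [inord] sends entries above [d] to 0, so this inverts [mindex_of] only on indices with all
    entries at most [d]. *)
Definition mindex_trunc d u : {ffun 'I_c -> 'I_d.+1} := [ffun i => inord (u i)].

Lemma mindex_truncK d u : (forall i, u i <= d)%N -> mindex_of (mindex_trunc d u) = u.
Proof. by move=> ud; apply/ffunP => i; rewrite !ffunE inordK // ltnS. Qed.

Lemma mindex_of_inj d : injective (@mindex_of d).
Proof. by move=> v w /ffunP e; apply/ffunP => i; apply: val_inj; move: (e i); rewrite !ffunE. Qed.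

Lemma sum_mindex_of (V : nzRingType) d (G : mindex c -> V) u :
  (forall i, u i <= d)%N ->
  \sum_(v : {ffun 'I_c -> 'I_d.+1}) (mindex_of v == u)%:R * G (mindex_of v) = G u.
Proof.
move=> ud; rewrite (bigD1 (mindex_trunc d u)) //= mindex_truncK // eqxx mul1r.
rewrite big1 ?addr0 // => v; rewrite -(inj_eq (@mindex_of_inj d)) mindex_truncK //.
by move=> /negPf->; rewrite mul0r.
Qed.

(** Choice without an axiom: the indices of weight at most [d] sit in a finite type, and the default
    [x0] serves all others. *)
Lemma mindex_fin_choice (T : finType) (X : Type) (x0 : X) d
    (P : mindex c -> T -> X -> Prop) :
  (forall u t, exists x, P u t x) -> (forall u t, (d < mabs u)%N -> P u t x0) ->
  exists w, forall u t, P u t (w u t).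
Proof.
move=> ex P0.
have [w wP] := fin_all_exists (fun vt : {ffun 'I_c -> 'I_d.+1} * T => ex (mindex_of vt.1) vt.2).
exists (fun u t => if (mabs u <= d)%N then w (mindex_trunc d u, t) else x0) => u t.
case: leqP => [ud|]; last exact: P0.
have := wP (mindex_trunc d u, t); rewrite /= mindex_truncK // => i.
exact: leq_trans (leq_mabs u i) ud.
Qed.

End MultiIndex.

(** * Membership in the ideal of part of the sequence *)

Section Ideal.
Variables (K : fieldType) (n c : nat) (a : 'I_c -> {mpoly K[n]}) (P : pred 'I_c).
Local Notation A := (in_ideal a P).

Lemma in_ideal0 : A 0.
Proof. by exists (fun _ => 0); rewrite big1 // => j _; rewrite mul0r. Qed.

Lemma in_idealD p q : A p -> A q -> A (p + q).
Proof.
move=> [g ->] [h ->]; exists (fun j => g j + h j).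
by rewrite -big_split; apply: eq_bigr => j _; rewrite mulrDl.
Qed.

Lemma in_idealM p q : A q -> A (p * q).
Proof.
move=> [h ->]; exists (fun j => p * h j).
by rewrite mulr_sumr; apply: eq_bigr => j _; rewrite mulrA.
Qed.

Lemma in_idealN p : A p -> A (- p).
Proof. by rewrite -mulN1r; apply: in_idealM. Qed.

Lemma in_idealB p q : A p -> A q -> A (p - q).
Proof. by move=> Ap Aq; apply: in_idealD => //; apply: in_idealN. Qed.

Lemma in_ideal_sum (I : finType) (F : I -> {mpoly K[n]}) :
  (forall i, A (F i)) -> A (\sum_i F i).
Proof. by move=> AF; elim/big_ind: _ => //; [apply: in_ideal0 | apply: in_idealD]. Qed.

Lemma in_ideal_gen j : P j -> A (a j).
Proof.
move=> Pj; exists (fun i => (i == j)%:R); rewrite (bigD1 j) //= eqxx mul1r.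
by rewrite big1 ?addr0 // => i /andP[_ /negPf->]; rewrite mul0r.
Qed.

End Ideal.

(** Links the initial segments used in the induction to the full ideal, reached at k = c. *)
Lemma in_ideal_predT (K : fieldType) (n c : nat) (a : 'I_c -> {mpoly K[n]}) p :
  in_ideal a predT p <-> in_ideal a (fun j => j < c)%N p.
Proof.
have e (h : 'I_c -> {mpoly K[n]}) : \sum_(j < c | predT j) h j * a j = \sum_(j < c | (j < c)%N) h j * a j.
  by apply: eq_bigl => j; rewrite ltn_ord.
by split=> -[h ->]; exists h; rewrite e.
Qed.

Section EisenbudShamash.
Variables (K : fieldType) (n r c : nat) (mm : 'I_r -> 'X_{1..n}).
Local Notation Q := {mpoly K[n]}.
Variables (a : 'I_c -> Q) (f : 'I_c -> 'I_r -> Q).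
Hypothesis aE : forall i : 'I_c, a i = \sum_(j < r) f i j * 'X_[mm j].
Local Notation tau := (taylor_diff mm : tmap K n r).
Local Notation sig i := (thomotopy mm (f i)).
Local Notation "u '+e' i" := (maddn u (munit i)) (at level 50, left associativity).
Implicit Types (x y z w : esvec K n r c) (u : mindex c) (S : {set 'I_r}).

(** * The system of higher homotopies *)

Lemma sigma_fam0 S' S : sigma_fam mm f (mzero c) S' S = tau S' S.
Proof.
rewrite /sigma_fam; case: pickP => [i|_]; last by rewrite eqxx.
by rewrite eq_sym (munit_neq0 i).
Qed.

Lemma sigma_fam1 i S' S : sigma_fam mm f (munit i) S' S = sig i S' S.
Proof.
rewrite /sigma_fam; case: pickP => [j /eqP/munit_inj <-|/(_ i)]; last by rewrite eqxx.
exact: sigma1E.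
Qed.

(** Indicators replace the case distinction, so that sums over multi-indices can be exchanged and
    collapsed. *)
Lemma sigma_famE u S' S : sigma_fam mm f u S' S =
  (u == mzero c)%:R * tau S' S + \sum_i (u == munit i)%:R * sig i S' S.
Proof.
have [->|u0] := eqVneq u (mzero c).
  rewrite sigma_fam0 mul1r big1 ?addr0 // => i _.
  by rewrite eq_sym munit_neq0 mul0r.
rewrite mul0r add0r.
have [i /eqP->|no] := pickP (fun i => u == munit i).
  rewrite sigma_fam1 (bigD1 i) //= eqxx mul1r big1 ?addr0 // => j ji.
  by rewrite (inj_eq (@munit_inj c)) eq_sym (negPf ji) mul0r.
rewrite big1 => [|i _]; last by rewrite no mul0r.
rewrite /sigma_fam; case: pickP => [i|_]; first by rewrite no.
by rewrite (negPf u0).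
Qed.

Lemma sigma_fam_degree u S' S :
  sigma_fam mm f u S' S != 0 -> (#|S'| + 1 = #|S| + 2 * mabs u)%N.
Proof.
have [->|u0] := eqVneq u (mzero c).
  by rewrite sigma_fam0 mabs_mzero => /taylor_diff_degree ->; lia.
have [i /eqP->|no] := pickP (fun i => u == munit i).
  by rewrite sigma_fam1 mabs_munit => /thomotopy_degree ->; lia.
rewrite sigma_famE (negPf u0) mul0r add0r big1 ?eqxx // => i _.
by rewrite no mul0r.
Qed.

Lemma eq_tcomp (M M' N N' : tmap K n r) S' S :
  (forall S' S, M S' S = M' S' S) -> (forall S' S, N S' S = N' S' S) ->
  tcomp M N S' S = tcomp M' N' S' S.
Proof. by move=> eM eN; apply: eq_bigr => S'' _; rewrite eM eN. Qed.

Lemma taylor_sigma j S' S :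
  tcomp tau (sig j) S' S + tcomp (sig j) tau S' S = (S' == S)%:R * a j.
Proof. by rewrite thomotopy_taylor aE. Qed.

(** If one factor is the Taylor differential, the other has weight at least 2 and is zero; only
    products of two weight-one maps survive. *)
Lemma tcomp_sigma_fam u v S' S : (2 <= mabs u + mabs v)%N ->
  tcomp (sigma_fam mm f u) (sigma_fam mm f v) S' S =
  \sum_i \sum_j (u == munit i)%:R * (v == munit j)%:R * tcomp (sig i) (sig j) S' S.
Proof.
have vanish (w : mindex c) S1 S2 : (2 <= mabs w)%N -> sigma_fam mm f w S1 S2 = 0.
  move=> w2; rewrite sigma_famE.
  case: eqP => [e|_]; first by rewrite e mabs_mzero in w2.
  rewrite mul0r add0r big1 // => i _.
  by case: eqP => [e|_]; rewrite ?mul0r //; rewrite e mabs_munit in w2.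
move=> uv; have [u0|u0] := eqVneq u (mzero c).
  rewrite u0 mabs_mzero add0n in uv.
  rewrite /tcomp big1 => [|X _]; last by rewrite [X in _ * X]vanish ?mulr0.
  rewrite big1 // => i _; rewrite big1 // => j _.
  by rewrite u0 eq_sym munit_neq0 !mul0r.
have [v0|v0] := eqVneq v (mzero c).
  rewrite v0 mabs_mzero addn0 in uv.
  rewrite /tcomp big1 => [|X _]; last by rewrite [X in X * _]vanish ?mul0r.
  rewrite big1 // => i _; rewrite big1 // => j _.
  by rewrite v0 [_ == munit j]eq_sym munit_neq0 mulr0 mul0r.
have E (w : mindex c) S1 S2 : w != mzero c ->
    sigma_fam mm f w S1 S2 = \sum_i (w == munit i)%:R * sig i S1 S2.
  by move=> /negPf w0; rewrite sigma_famE w0 mul0r add0r.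
rewrite /tcomp; under eq_bigr do rewrite !E // mulr_suml.
rewrite exchange_big; apply: eq_bigr => i _ /=.
under eq_bigr do rewrite mulr_sumr.
rewrite exchange_big; apply: eq_bigr => j _ /=.
by rewrite mulr_sumr; apply: eq_bigr => X _; rewrite mulrACA.
Qed.

Lemma sigma_higher_homotopies : higher_homotopies tau a (sigma_fam mm f).
Proof.
split; first exact: sigma_fam_degree.
split; first exact: sigma_fam0.
split=> [j S' S|u u2 S' S].
  rewrite -taylor_sigma; congr (_ + _); apply: eq_tcomp => *;
    by rewrite ?sigma_fam0 ?sigma_fam1.
pose le (b : mindex c) := [forall i, (b i <= u i)%N].
have leE (b : {ffun 'I_c -> 'I_(mabs u).+1}) :
    [forall i, (b i <= u i)%N] = le (mindex_of b).
  by apply: eq_forallb => i; rewrite ffunE.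
pose T i j := tcomp (sig i) (sig j) S' S.
(* The sum over [b] is regrouped by pairs with b = e_i and u - b = e_j, giving an alternating double
   sum; [le b] rules out truncation in [msubn]. *)
pose G i j (b : mindex c) : Q := (le b && (msubn u b == munit j))%:R * T i j.
transitivity (\sum_i \sum_j \sum_(b : {ffun 'I_c -> 'I_(mabs u).+1})
    (mindex_of b == munit i)%:R * G i j (mindex_of b)).
  under [RHS]eq_bigr do rewrite exchange_big.
  rewrite [RHS]exchange_big big_mkcond; apply: eq_bigr => b _ /=; rewrite leE.
  rewrite -/(mindex_of b) /G; case: ifP => bu /=; last first.
    by rewrite big1 // => i _; rewrite big1 // => j _; rewrite mul0r mulr0.
  rewrite tcomp_sigma_fam.
    by apply: eq_bigr => i _; apply: eq_bigr => j _; rewrite mulrA.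
  suff -> : (mabs (mindex_of b) + mabs (msubn u (mindex_of b)))%N = mabs u by [].
  rewrite -mabsD; congr mabs; apply/ffunP => i; rewrite !ffunE subnKC //.
  by move/forallP/(_ i): bu; rewrite ffunE.
have GE i j : G i j (munit i) = (u == maddn (munit i) (munit j))%:R * T i j.
  rewrite /G /le; congr (_%:R * _); congr nat_of_bool; apply/andP/eqP => [[/forallP l /eqP <-]|->].
    by apply/ffunP => k; move: (l k); rewrite !ffunE => /subnKC.
  split; last by rewrite maddnC maddnK.
  by apply/forallP => k; rewrite !ffunE leq_addr.
transitivity (\sum_i \sum_j (u == maddn (munit i) (munit j))%:R * T i j).
  apply: eq_bigr => i _; apply: eq_bigr => j _; rewrite (sum_mindex_of (G i j)) ?GE // => k.
  by rewrite (leq_trans (leq_mabs _ _)) // mabs_munit ltnW.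
apply: sum_alternating => [i|i j ij]; rewrite /T.
  by rewrite thomotopy_sqr mulr0.
by rewrite maddnC -mulrN; congr (_ * _); apply/eqP; rewrite -addr_eq0 thomotopy_anticomm.
Qed.

(** * The Eisenbud-Shamash map on representatives over [Q] *)

Definition es_phi x : esvec K n r c := fun u S =>
  tapp tau (x u) S + \sum_i tapp (sig i) (x (u +e i)) S.

(** Only the indices 0 and e_i contribute; [0 < d] ensures that the bounded sum contains e_i. *)
Lemma es_diffE d x u S : (0 < d)%N -> es_diff (sigma_fam mm f) d x u S = es_phi x u S.
Proof.
move=> d0; rewrite /es_diff.
pose G M v : Q := tapp M (x (maddn u v)) S.
transitivity (\sum_(v : {ffun 'I_c -> 'I_d.+1}) ((mindex_of v == mzero c)%:R * G tau (mindex_of v)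
   + \sum_i (mindex_of v == munit i)%:R * G (sig i) (mindex_of v))).
  apply: eq_bigr => v _; rewrite -/(mindex_of v) /G /tapp.
  under eq_bigr do rewrite sigma_famE mulrDl mulr_suml.
  rewrite big_split exchange_big /= mulr_sumr; congr (_ + _).
    by apply: eq_bigr => S' _; rewrite mulrA.
  by apply: eq_bigr => i _; rewrite mulr_sumr; apply: eq_bigr => S' _; rewrite mulrA.
rewrite big_split exchange_big /= sum_mindex_of => [|i]; last by rewrite ffunE.
rewrite /G maddn0; congr (_ + _); apply: eq_bigr => i _.
rewrite (sum_mindex_of (fun v => tapp (sig i) (x (maddn u v)) S)) // => j.
by rewrite (leq_trans (leq_mabs _ _)) // mabs_munit.
Qed.

Lemma eq_es_phi x y u S : (forall u S, x u S = y u S) -> es_phi x u S = es_phi y u S.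
Proof.
move=> e; congr (_ + _); first by apply: eq_tapp => // ?; rewrite e.
by apply: eq_bigr => i _; apply: eq_tapp => // ?; rewrite e.
Qed.

Lemma es_phiB x y u S :
  es_phi (fun u S => x u S - y u S) u S = es_phi x u S - es_phi y u S.
Proof.
rewrite /es_phi tappB; under eq_bigr do rewrite tappB.
by rewrite sumrB opprD addrACA.
Qed.

Lemma es_phiD x y u S :
  es_phi (fun u S => x u S + y u S) u S = es_phi x u S + es_phi y u S.
Proof.
rewrite /es_phi tappD; under eq_bigr do rewrite tappD.
by rewrite big_split addrACA.
Qed.

(** The square of the Taylor differential vanishes, the mixed terms give a_i t_i, and the products
    of two homotopies cancel in pairs because t_i and t_j commute. *)
Lemma es_phi_phi x u S : es_phi (es_phi x) u S = \sum_j a j * x (u +e j) S.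
Proof.
rewrite {1}/es_phi {1}/es_phi tappD tapp_comp tapp_eq0 ?add0r; last first.
  exact: taylor_taylor.
rewrite tapp_sum -big_split /=.
transitivity (\sum_i ((a i * x (u +e i) S) +
    \sum_j tapp (tcomp (sig i) (sig j)) (x (u +e i +e j)) S)).
  apply: eq_bigr => i _; rewrite /es_phi tappD !tapp_comp addrA; congr (_ + _).
    rewrite /tapp -big_split /= (bigD1 S) //= -mulrDl taylor_sigma eqxx mul1r.
    rewrite big1 ?addr0 // => S' S'S.
    by rewrite -mulrDl taylor_sigma eq_sym (negPf S'S) !mul0r.
  by rewrite tapp_sum; apply: eq_bigr => j _; rewrite tapp_comp.
rewrite big_split /= [X in _ + X]sum_alternating ?addr0 // => [i|i j ij].
  by apply: tapp_eq0 => *; apply: thomotopy_sqr.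
rewrite maddnA (maddnC (munit j)) -maddnA /tapp -sumrN; apply: eq_bigr => S' _.
by rewrite -mulNr; congr (_ * _); apply/eqP; rewrite -addr_eq0 thomotopy_anticomm.
Qed.

Lemma es_phi_ideal (P : pred 'I_c) x u S :
  (forall u S, in_ideal a P (x u S)) -> in_ideal a P (es_phi x u S).
Proof.
move=> Ax; apply: in_idealD; last apply: in_ideal_sum => i.
  by apply: in_ideal_sum => S'; apply: in_idealM.
by apply: in_ideal_sum => S'; apply: in_idealM.
Qed.

Lemma es_phi_neq0 x u S : es_phi x u S != 0 ->
  (exists S', #|S'| = #|S|.+1 /\ x u S' != 0) \/
  (exists i S', #|S| = #|S'|.+1 /\ x (u +e i) S' != 0).
Proof.
have nz (M : tmap K n r) g : tapp M g S != 0 -> exists S', M S S' != 0 /\ g S' != 0.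
  move=> /sum_neq0[S']; rewrite mulf_eq0 negb_or => /andP[? ?]; by exists S'.
rewrite /es_phi; have [->|/nz[S' [/taylor_diff_degree ? ?]] _] := eqVneq (tapp tau (x u) S) 0.
  rewrite add0r => /sum_neq0[i /nz[S' [/thomotopy_degree ? ?]]].
  by right; exists i, S'.
by left; exists S'.
Qed.

Lemma es_phi_degree x N u S : in_degree x N -> es_phi x u S != 0 -> (esdeg u S).+1 = N.
Proof.
move=> xN /es_phi_neq0[[S' [e /xN <-]]|[i [S' [e /xN <-]]]]; rewrite /esdeg e.
  by rewrite addnS.
by rewrite mabsD mabs_munit; lia.
Qed.

(** * Exactness by induction along the regular sequence *)

Definition ysupp k x := forall u S, x u S != 0 -> forall j : 'I_c, (k <= j)%N -> u j = 0%N.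

Lemma es_phi_ysupp k x : ysupp k x -> ysupp k (es_phi x).
Proof.
move=> xk u S /es_phi_neq0[[S' [_ /xk h]]|[i [S' [_ /xk h]]]] j kj; first exact: h.
by have := h j kj; rewrite ffunE; lia.
Qed.

(** Sends y^(u) to y^(u + e_i), a right inverse of t_i. Multiplication by y_i in the divided power
    algebra would bring in the factor u_i + 1. *)
Definition yshift i x : esvec K n r c := fun u S =>
  if u i == 0%N then 0 else x (msubn u (munit i)) S.

Lemma yshiftK i x u S : yshift i x (u +e i) S = x u S.
Proof. by rewrite /yshift !ffunE eqxx addn1 maddnK. Qed.

Lemma yshift_degree i x N : in_degree x N -> in_degree (yshift i x) N.+2.
Proof.
move=> xN u S; rewrite /yshift; case: ifP => [_|/negbT ui]; first by rewrite eqxx.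
by move/xN <-; rewrite /esdeg -[in LHS](msubnK ui) mabsD mabs_munit; lia.
Qed.

(** Only the cycle is confined to the first [k] variables; [z] is free. At k = c the confinement is
    vacuous and this is exactness over R. *)
Definition es_exact_mod k := forall N x, (0 < N)%N -> in_degree x N -> ysupp k x ->
  (forall u S, in_ideal a (fun j => j < k)%N (es_phi x u S)) ->
  exists z, in_degree z N.+1 /\
    forall u S, in_ideal a (fun j => j < k)%N (es_phi z u S - x u S).

(** The ideal is zero and [x] lives on y^(0), so [x] is a cycle of the Taylor complex and bounds
    there. *)
Lemma es_exact_mod0 : es_exact_mod 0.
Proof.
move=> N x N0 xN x0 phi0.
have xE u S : u != mzero c -> x u S = 0.
  move=> u0; apply/eqP; apply: contraNT u0 => /x0 h.
  by apply/eqP/ffunP => j; rewrite h // ffunE.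
have tx0 S : tapp tau (x (mzero c)) S = 0.
  have [h] := phi0 (mzero c) S; rewrite big_pred0 // /es_phi [X in _ + X]big1 ?addr0 // => i _.
  by rewrite /tapp big1 // => S' _; rewrite xE ?mulr0 // maddn_munit_neq0.
have [S /xN|z [zN zx]] := taylor_exact (mm := mm) N0 _ tx0.
  by rewrite /esdeg mabs_mzero.
exists (fun u S => if u == mzero c then z S else 0); split=> u S.
  case: ifP => [/eqP->|_]; last by rewrite eqxx.
  by rewrite /esdeg mabs_mzero => /zN ->.
suff -> : es_phi (fun u S => if u == mzero c then z S else 0) u S = x u S.
  by rewrite subrr; apply: in_ideal0.
rewrite /es_phi [X in _ + X]big1 ?addr0 => [|i _]; last first.
  by rewrite maddn_munit_neq0 /tapp big1 // => S' _; rewrite mulr0.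
have [->|u0] := eqVneq u (mzero c); first exact: zx.
by rewrite xE // /tapp big1 // => S' _; rewrite mulr0.
Qed.

(* Writing [phi x = a_k w] modulo the previous [a_j], the identity
   [phi^2 = sum_j a_j t_j] gives [a_k (t_k x - phi w) = 0], so by regularity
   [t_k x = phi w]; hence [x - phi (y_k w)] no longer involves [y_k]. *)
Lemma es_exact_modS (k : 'I_c) : regular_seq a -> es_exact_mod k -> es_exact_mod k.+1.
Proof.
move=> [reg _] IH N x N0 xN xk phix.
pose A := in_ideal a (fun j => j < k)%N.
have AS p : A p -> in_ideal a (fun j => j < k.+1)%N p.
  move=> [h ->]; exists (fun j : 'I_c => if (j < k)%N then h j else 0).
  rewrite [RHS]big_mkcond [LHS]big_mkcond; apply: eq_bigr => j _.
  by rewrite ltnS; case: ltngtP; rewrite ?mul0r.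
(* Taking [w] to be 0 wherever [es_phi x] vanishes lets it inherit the degree and the variables of
   [es_phi x]. *)
have [w wP] : exists w, forall u S,
    (es_phi x u S = 0 -> w u S = 0) /\ A (es_phi x u S - a k * w u S).
  apply: (@mindex_fin_choice c _ _ 0 N (fun u S q =>
    (es_phi x u S = 0 -> q = 0) /\ A (es_phi x u S - a k * q))) => u S.
    have [-> | ne] := eqVneq (es_phi x u S) 0.
      by exists 0; split=> //; rewrite mulr0 subr0; apply: in_ideal0.
    have [h hE] := phix u S; exists (h k); split; first by move=> e; rewrite e eqxx in ne.
    exists h; rewrite hE (bigD1 k) //= mulrC addrAC subrr add0r.
    by apply: eq_bigl => j; rewrite ltnS ltn_neqAle andbC.
  (* A nonzero coefficient of [es_phi x] has degree N - 1, so none occurs at weight above [N] and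
     the default 0 is valid. *)
  move=> Nu; split=> //; rewrite mulr0 subr0.
  have [->|/(es_phi_degree xN)] := eqVneq (es_phi x u S) 0; first exact: in_ideal0.
  by rewrite /esdeg; lia.
have wphi u S : w u S != 0 -> es_phi x u S != 0.
  by apply: contra_neq => /(proj1 (wP u S)).
have wN : in_degree w N.-1.
  by move=> u S /wphi/(es_phi_degree xN) <-.
have wk : ysupp k.+1 w by move=> u S /wphi; apply: es_phi_ysupp.
have other (j : 'I_c) : j != k -> (j < k)%N \/ (k.+1 <= j)%N.
  by rewrite -(inj_eq val_inj) /=; case: ltngtP => //; [left | right].
(* In the sum of the a_j t_j y, terms with j < k lie in the ideal and those with j > k vanish by the
   support condition. *)
have Koszul y u S : ysupp k.+1 y ->
    A (es_phi (es_phi y) u S - a k * y (u +e k) S).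
  move=> yk; rewrite es_phi_phi (bigD1 k) //= addrAC subrr add0r.
  rewrite big_mkcond; apply: in_ideal_sum => j.
  case: (boolP (j == k)) => [_|/other[jk|kj]]; first exact: in_ideal0.
    by rewrite mulrC; apply/in_idealM/in_ideal_gen.
  have [->|/yk/(_ j kj)] := eqVneq (y (u +e j) S) 0.
    by rewrite mulr0; apply: in_ideal0.
  by rewrite !ffunE eqxx addn1.
have tkx u S : A (x (u +e k) S - es_phi w u S).
  apply: reg; rewrite mulrBr.
  (* Applying phi to phi x - a_k w stays in the ideal, and phi^2 x agrees with a_k t_k x there. *)
  have -> : a k * x (u +e k) S - a k * es_phi w u S =
     es_phi (fun u S => es_phi x u S - a k * w u S) u S
     - (es_phi (es_phi x) u S - a k * x (u +e k) S).
    rewrite es_phiB.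
    have -> : es_phi (fun u S => a k * w u S) u S = a k * es_phi w u S.
      rewrite /es_phi tappZ; under eq_bigr do rewrite tappZ.
      by rewrite -mulr_sumr mulrDr.
    by ring.
  apply: in_idealB; last exact: Koszul.
  by apply: es_phi_ideal => u' S'; apply: (proj2 (wP _ _)).
pose W := yshift k w.
have Wk : ysupp k.+1 W.
  move=> u S; rewrite /W /yshift; case: ifP => [_|_]; first by rewrite eqxx.
  move=> /wk h j kj; have := h j kj; rewrite !ffunE.
  by case: eqP => [e|_]; [move: kj; rewrite e ltnn | lia].
have WN : in_degree W N.+1.
  by have := yshift_degree (i := k) wN; rewrite prednK.
pose x1 : esvec K n r c := fun u S => x u S - es_phi W u S.
(* The coefficients of [x1] at positive powers of y_k are only congruent to 0; [x2] erases them, so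
   that the induction hypothesis applies literally. *)
pose x2 : esvec K n r c := fun u S => if u k == 0%N then x1 u S else 0.
have x1N : in_degree x1 N.
  move=> u S; rewrite /x1; have [-> | /xN //] := eqVneq (x u S) 0.
  by rewrite sub0r oppr_eq0 => /(es_phi_degree WN) [].
have x1k : ysupp k.+1 x1.
  move=> u S; rewrite /x1; have [-> | /xk //] := eqVneq (x u S) 0.
  by rewrite sub0r oppr_eq0; apply: es_phi_ysupp.
have x12 u S : A (x1 u S - x2 u S).
  rewrite /x2; case: eqP => [_|/eqP uk]; first by rewrite subrr; apply: in_ideal0.
  rewrite subr0 /x1 -(msubnK uk); set v := msubn u _.
  (* At a positive power of y_k the shift commutes with phi, so the coefficient there is that of t_k
     x - phi w. *)
  suff -> : es_phi W (v +e k) S = es_phi w v S by apply: tkx.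
  congr (_ + _); first by apply: eq_tapp => // S'; rewrite /W yshiftK.
  apply: eq_bigr => i _; apply: eq_tapp => // S'.
  by rewrite maddnA [maddn (munit k) _]maddnC -maddnA /W yshiftK.
have [||u S|z [zN zx]] := IH N x2 N0.
- by move=> u S; rewrite /x2; case: ifP => _; [apply: x1N | rewrite eqxx].
- move=> u S; rewrite /x2; case: ifP => [/eqP uk|_]; last by rewrite eqxx.
  move=> /x1k h j; rewrite leq_eqVlt => /predU1P[/val_inj <- //|]; exact: h.
(* Since t_k W = w, both phi x and phi^2 W are congruent to a_k w, hence phi (x - phi W) lies in the
   ideal. *)
- have -> : es_phi x2 u S =
      (es_phi x u S - a k * w u S) - (es_phi (es_phi W) u S - a k * W (u +e k) S)
      - es_phi (fun u S => x1 u S - x2 u S) u S.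
    by rewrite /x1 !es_phiB /W yshiftK; ring.
  apply: in_idealB; first apply: in_idealB.
  + exact: (proj2 (wP u S)).
  + exact: Koszul.
  + exact: es_phi_ideal.
(* x = x1 + phi W, with x1 congruent to x2 and x2 to phi z. *)
exists (fun u S => z u S + W u S); split=> u S.
  by have [-> | /zN //] := eqVneq (z u S) 0; rewrite add0r => /WN.
apply: AS; rewrite es_phiD.
have -> : es_phi z u S + es_phi W u S - x u S =
   (es_phi z u S - x2 u S) - (x1 u S - x2 u S) by rewrite /x1; ring.
by apply: in_idealB; [apply: zx | apply: x12].
Qed.

Lemma es_exact : regular_seq a -> es_exact_mod c.
Proof.
move=> reg; suff h k : (k <= c)%N -> es_exact_mod k by apply: h.
elim: k => [_|k IH kc]; first exact: es_exact_mod0.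
exact: (@es_exact_modS (Ordinal kc)) reg (IH (ltnW kc)).
Qed.

(** * Homology in degree zero and the resolution *)

Lemma mlcmS1 j : mlcmS mm [set j] = mm j.
Proof.
have le : (mlcmS mm [set j] <= mm j)%MM.
  by apply/mlcmS_leP => i /set1P ->; apply: lepm_refl.
have /mnm_lepP ge := mnm_le_mlcmS mm (set11 j).
by apply/mnmP => i; apply/eqP; rewrite eqn_leq ge (mnm_lepP le).
Qed.

(** Homotopies insert an index and never reach the empty set, so only the Taylor differential of the
    singletons contributes, with coefficients m_j. *)
Lemma es_phi_bottom x :
  es_phi x (mzero c) set0 = \sum_j x (mzero c) [set j] * 'X_[mm j].
Proof.
rewrite /es_phi [X in _ + X]big1 => [|i _]; last first.
  rewrite /tapp big1 // => S _; have [->|/thomotopy_degree] := eqVneq (sig i set0 S) 0.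
    by rewrite mul0r.
  by rewrite cards0.
rewrite addr0 /tapp; under eq_bigr do rewrite taylor_diffE mulr_suml.
rewrite (exchange_big_dep xpredT) //=; apply: eq_bigr => j _.
rewrite (bigD1 [set j]) ?set11 //= big1 ?addr0 => [|S /andP[jS Sj]]; last first.
  case: eqP => [e|_]; rewrite ?mul0r //; case/eqP: Sj.
  by rewrite -(setD1K jS) -e setU0.
rewrite setDv eqxx mul1r mulrC; congr (_ * _).
rewrite /dcoef setDv mlcmS1 /sgn.
have -> : [set y in [set j] | (j < y)%N] = set0.
  by apply/setP=> y; rewrite !inE; case: eqP => // ->; rewrite ltnn.
rewrite cards0 mul1r /mlcmS big_set0; congr ('X_[_]).
by apply/mnmP => i; rewrite mnmBE mnm0E subn0.
Qed.

Lemma taylor_es_free_resolution :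
  regular_seq a -> es_free_resolution mm a (sigma_fam mm f).
Proof.
move=> reg; split=> [d x _ u S|].
  rewrite /congr_a subr0 es_diffE // (eq_es_phi (y := es_phi x)) => [|u' S'].
    rewrite es_phi_phi; apply: in_ideal_sum => j.
    by rewrite mulrC; apply/in_idealM/in_ideal_gen.
  exact: es_diffE.
split=> [d x d1 xd phix|p].
  have [|u S|z [zd zx]] := es_exact reg d1 xd.
  - by move=> u S _ j; rewrite leqNgt ltn_ord.
  - by apply/in_ideal_predT; have := phix u S; rewrite /congr_a subr0 es_diffE.
  by exists z; split=> // u S; rewrite /congr_a es_diffE //; apply/in_ideal_predT.
split=> [[z [_]]|[g [h ->]]].
  rewrite /congr_a es_diffE // es_phi_bottom => -[h e].
  exists (fun j => z (mzero c) [set j]), (fun i => - h i).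
  rewrite -[LHS](subKr (\sum_j z (mzero c) [set j] * 'X_[mm j])) e -sumrN.
  by congr (_ + _); apply: eq_bigr => i _; rewrite mulNr.
(* The element of degree 1 with coefficient g_j on the singleton {j}, placed at y^(0). *)
exists (fun u S => if u == mzero c then \sum_j (S == [set j])%:R * g j else 0); split.
  move=> u S; case: ifP => [/eqP->|_]; last by rewrite eqxx.
  move=> /sum_neq0[j]; case: (S =P _) => [->|_]; last by rewrite mul0r eqxx.
  by rewrite /esdeg mabs_mzero cards1.
rewrite /congr_a es_diffE // es_phi_bottom eqxx.
(* The congruence is a membership of the image minus [p], hence the negated [h]. *)
exists (fun i => - h i); rewrite opprD addrA.
under eq_bigr => j _.
  rewrite (bigD1 j) //= eqxx mul1r big1 ?addr0; first over.
  by move=> i ij; rewrite (inj_eq set1_inj) eq_sym (negPf ij) mul0r.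
rewrite subrr add0r -sumrN.
by apply: eq_bigr => i _; rewrite mulNr.
Qed.

End EisenbudShamash.

Theorem theorem3p2 (K : fieldType) (n r c : nat)
    (mm : 'I_r -> 'X_{1..n}) (a : 'I_c -> {mpoly K[n]})
    (f : 'I_c -> 'I_r -> {mpoly K[n]}) :
  regular_seq a ->
  (forall i : 'I_c, a i = \sum_(j < r) f i j * 'X_[mm j]) ->
  (higher_homotopies (taylor_diff mm) a (sigma_fam mm f) /\
   (forall (i : 'I_c) S' S, tcomp (sigma1 mm f i) (sigma1 mm f i) S' S = 0) /\
   (forall i j : 'I_c, i != j -> forall S' S,
      tcomp (sigma1 mm f i) (sigma1 mm f j) S' S
      + tcomp (sigma1 mm f j) (sigma1 mm f i) S' S = 0) /\
   (forall (j : 'I_c) S' S,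
      tcomp (taylor_diff mm) (sigma1 mm f j) S' S
      + tcomp (sigma1 mm f j) (taylor_diff mm) S' S = (S' == S)%:R * a j)) /\
  es_free_resolution mm a (sigma_fam mm f).
Proof.
move=> reg aE; split; last exact: taylor_es_free_resolution.
split; first exact: sigma_higher_homotopies.
split=> [i S' S|].
  by rewrite (eq_tcomp _ _ (sigma1E mm f i) (sigma1E mm f i)) thomotopy_sqr.
split=> [i j _ S' S|j S' S].
  rewrite (eq_tcomp _ _ (sigma1E mm f i) (sigma1E mm f j)).
  by rewrite (eq_tcomp _ _ (sigma1E mm f j) (sigma1E mm f i)) thomotopy_anticomm.
rewrite -(taylor_sigma aE); congr (_ + _); apply: eq_tcomp => // *; exact: sigma1E.
Qed.
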